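(* There is a computable (many-one) reduction $\mathsf{\exists Thm}(\mathsf{NMatr})\leq\overline{\mathsf{Eqv}(\mathsf{NMatr})}$ from the theorem existence problem for finite Nmatrices to the dual of the equivalence problem for finite Nmatrices.
   Context: A signature $\Sigma$ is a family $\{\Sigma^{(k)}:k\in\mathbb{N}_0\}$ of sets of connectives indexed by arity; it is finite if it has only finitely many connectives in total. $P=\{p_i:i\in\mathbb{N}\}$ is the set of propositional variables, and $L_\Sigma(P)$ is the set of formulas built from $P$ using connectives in $\Sigma$. A $\Sigma$-Nmatrix is a triple $\mathbb{M}=\langle V,D,\cdot_{\mathbb{M}}\rangle$ with $V$ a non-empty set of truth-values, $D\subseteq V$ the designated values, and, for each $c\in\Sigma^{(k)}$, a multi-function $c_{\mathbb{M}}:V^k\to 2^V\setminus\{\emptyset\}$. It is finite if both $V$ and $\Sigma$ are finite. A valuation of $\mathbb{M}$ is a function $v:L_\Sigma(P)\to V$ with $v(c(A_1,\dots,A_k))\in c_{\mathbb{M}}(v(A_1),\dots,v(A_k))$ for all $k\in\mathbb{N}_0$, $c\in\Sigma^{(k)}$ and formulas $A_1,\dots,A_k$. $\Gamma\vdash_{\mathbb{M}}A$ iff every valuation $v$ of $\mathbb{M}$ with $v(\Gamma)\subseteq D$ satisfies $v(A)\in D$. $\mathsf{Thm}(\Sigma,\vdash_{\mathbb{M}})=\{A\in L_\Sigma(P):\emptyset\vdash_{\mathbb{M}}A\}$. $\mathsf{NMatr}$ is the class of all finite Nmatrices. $\mathsf{\exists Thm}(\mathsf{NMatr})$: given a finite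 signature $\Sigma$ and a finite $\Sigma$-Nmatrix $\mathbb{M}$, determine whether $\mathsf{Thm}(\Sigma,\vdash_{\mathbb{M}})\neq\emptyset$. $\mathsf{Eqv}(\mathsf{NMatr})$: given a finite signature $\Sigma$ and finite $\Sigma$-Nmatrices $\mathbb{M}_1,\mathbb{M}_2$, determine whether $\vdash_{\mathbb{M}_1}=\vdash_{\mathbb{M}_2}$. The dual $\overline{\mathsf{Eqv}(\mathsf{NMatr})}$ has the same inputs and asks whether $\vdash_{\mathbb{M}_1}\neq\vdash_{\mathbb{M}_2}$. $\mathsf{P}\leq\mathsf{Q}$ means there is a computable function mapping inputs of $\mathsf{P}$ to inputs of $\mathsf{Q}$ that preserves yes/no answers. Finite signatures and Nmatrices are given under any standard finite encoding. *)

(* Defs.v *)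
From mathcomp Require Import all_boot.
From mathcomp Require Import boolp.
Set Implicit Arguments.
Unset Strict Implicit.
Unset Printing Implicit Defensive.

Definition signature := nat -> Type.

Inductive formula (S : signature) : Type :=
| Var of nat
| App (k : nat) of S k & (formula S ^ k)%type.

Record nmatrix (S : signature) := Nmatrix {
  nm_val : Type;
  nm_val_inhabited : inhabited nm_val;
  nm_des : nm_val -> Prop;
  (* [nm_op c x y] reads: y belongs to c_M(x) *)
  nm_op : forall k, S k -> (nm_val ^ k)%type -> nm_val -> Prop;
  nm_op_nonempty : forall k (c : S k) x, exists y, nm_op c x y }.

Definition is_valuation S (M : nmatrix S) (v : formula S -> nm_val M) : Prop :=
  forall k (c : S k) (A : (formula S ^ k)%type),
    nm_op c [ffun i => v (A i)] (v (App c A)).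

Definition entails S (M : nmatrix S) (G : formula S -> Prop) (A : formula S) :
    Prop :=
  forall v : formula S -> nm_val M, is_valuation v ->
    (forall B, G B -> nm_des (v B)) -> nm_des (v A).

Definition is_theorem S (M : nmatrix S) (A : formula S) : Prop :=
  entails M (fun _ => False) A.

(* A finite signature is presented by its numbers of connectives of arity
   0, 1, 2, ...; there is none of arity [k >= size s]. *)
Definition fin_sig := seq nat.

Definition sig_of (s : fin_sig) : signature := fun k => 'I_(nth 0 s k).

(* The truth-values are 0, ..., fn_n. *)
Record fin_nmatrix (s : fin_sig) := FinNmatrix {
  fn_n : nat;
  fn_des : {set 'I_fn_n.+1};
  fn_op : forall k, sig_of s k ->
    {ffun ('I_fn_n.+1 ^ k)%type -> {set 'I_fn_n.+1}};
  fn_op_nonempty : forall k (c : sig_of s k) x, fn_op c x != set0 }.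

Lemma fn_op_inhab s (M : fin_nmatrix s) k (c : sig_of s k)
    (x : ('I_(fn_n M).+1 ^ k)%type) : exists y, y \in fn_op M c x.
Proof. exact/set0Pn/fn_op_nonempty. Qed.

Definition nmatrix_of s (M : fin_nmatrix s) : nmatrix (sig_of s) :=
  @Nmatrix (sig_of s) 'I_(fn_n M).+1 (inhabits ord0)
    (fun a => a \in fn_des M) (fun k c x y => y \in fn_op M c x)
    (@fn_op_inhab s M).

Definition code_set n (A : {set 'I_n}) : nat :=
  CodeSeq.code [seq val a | a <- enum A].

(* The little-endian base n.+1 digits of i, for i < n.+1 ^ k: this fixes the
   order in which the entries of a truth table are listed. *)
Definition digits n k (i : nat) : ('I_n.+1 ^ k)%type :=
  [ffun j : 'I_k => inord (i %/ n.+1 ^ j %% n.+1)].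

Definition code_table n k (t : {ffun ('I_n.+1 ^ k)%type -> {set 'I_n.+1}}) :
    nat :=
  CodeSeq.code [seq code_set (t (digits n k i)) | i <- iota 0 (n.+1 ^ k)].

Definition code_ops s (M : fin_nmatrix s) (k : nat) : nat :=
  CodeSeq.code
    [seq code_table (@fn_op s M k c) | c <- enum 'I_(nth 0 s k)].

Definition code_nmatrix s (M : fin_nmatrix s) : nat :=
  CodeSeq.code [:: (fn_n M).+1; code_set (fn_des M);
    CodeSeq.code [seq code_ops M k | k <- iota 0 (size s)]].

Lemma code_inj : injective CodeSeq.code.
Proof. exact: can_inj CodeSeq.codeK. Qed.

Lemma code_set_inj n : injective (@code_set n).
Proof.
move=> A B /code_inj /(inj_map val_inj) eAB.
by apply/setP => x; rewrite -[LHS]mem_enum -[RHS]mem_enum eAB.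
Qed.

Lemma digits_surj n k (x : ('I_n.+1 ^ k)%type) :
  exists2 i, i < n.+1 ^ k & digits n k i = x.
Proof.
suff [i lti ei] : exists2 i, i < n.+1 ^ k &
    forall j : 'I_k, i %/ n.+1 ^ j %% n.+1 = x j.
  by exists i => //; apply/ffunP => j; rewrite ffunE ei inord_val.
elim: k x => [|k IHk] x; first by exists 0 => // -[].
have [i lti ei] := IHk [ffun j => x (lift ord0 j)].
exists (i * n.+1 + x ord0).
  rewrite expnSr; apply: (@leq_trans (i.+1 * n.+1)); last by rewrite leq_mul2r lti.
  by rewrite mulSn addnC ltn_add2r ltn_ord.
move=> j; case: (unliftP ord0 j) => [j' ->|->].
  rewrite lift0 expnS divnMA divnMDl // (divn_small (ltn_ord _)) addn0 ei.
  by rewrite ffunE.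
by rewrite expn0 divn1 modnMDl modn_small ?ltn_ord.
Qed.

Lemma code_table_inj n k : injective (@code_table n k).
Proof.
move=> t u /code_inj /eq_in_map etu; apply/ffunP => x.
have [i lti <-] := digits_surj x; apply: code_set_inj.
by apply: etu; rewrite mem_iota.
Qed.

Lemma code_nmatrix_inj s : injective (@code_nmatrix s).
Proof.
move=> [n D op opP] [n' D' op' opP'] /code_inj /= [en].
case: n' / en in D' op' opP' *.
move=> /code_set_inj eD /code_inj /eq_in_map eop.
case: D' / eD eop => eop.
suff eo : op = op'.
  by case: op' / eo opP' {eop} => opP'; rewrite (Prop_irrelevance opP opP').
apply: functional_extensionality_dep => k.
apply: functional_extensionality_dep => c.
have ltk : k < size s.
  rewrite ltnNge; apply/negP => /(nth_default 0) e0.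
  by move: c; rewrite /sig_of e0 => -[].
have /eop /code_inj /eq_in_map ek : k \in iota 0 (size s) by rewrite mem_iota.
by apply: code_table_inj; apply: ek; rewrite mem_enum.
Qed.

Record problem := Problem {
  input : Type;
  code_input : input -> nat;
  code_input_inj : injective code_input;
  answer : input -> Prop }.

Definition dual (P : problem) : problem :=
  @Problem (input P) (@code_input P) (@code_input_inj P)
    (fun x => ~ answer x).

Definition exThm_input := {s : fin_sig & fin_nmatrix s}.

Definition code_exThm (x : exThm_input) : nat :=
  CodeSeq.code [:: CodeSeq.code (projT1 x); code_nmatrix (projT2 x)].

Lemma code_exThm_inj : injective code_exThm.
Proof.
move=> [s M] [s' M'] /code_inj /= [/code_inj es].
by case: s' / es in M' * => /code_nmatrix_inj ->.
Qed.

Definition exThm_NMatr : problem :=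
  @Problem exThm_input code_exThm code_exThm_inj
    (fun x => exists A, is_theorem (nmatrix_of (projT2 x)) A).

Definition Eqv_input := {s : fin_sig & (fin_nmatrix s * fin_nmatrix s)%type}.

Definition code_Eqv (x : Eqv_input) : nat :=
  CodeSeq.code [:: CodeSeq.code (projT1 x);
    code_nmatrix (projT2 x).1; code_nmatrix (projT2 x).2].

Lemma code_Eqv_inj : injective code_Eqv.
Proof.
move=> [s [M1 M2]] [s' [M1' M2']] /code_inj /= [/code_inj es].
by case: s' / es in M1' M2' * => /code_nmatrix_inj -> /code_nmatrix_inj ->.
Qed.

Definition Eqv_NMatr : problem :=
  @Problem Eqv_input code_Eqv code_Eqv_inj
    (fun x => forall G A, entails (nmatrix_of (projT2 x).1) G A <->
                          entails (nmatrix_of (projT2 x).2) G A).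

Inductive recfn : nat -> Type :=
| rZero n : recfn n
| rSucc : recfn 1
| rProj n of 'I_n : recfn n
| rComp m n of recfn m & ('I_m -> recfn n) : recfn n
| rPrim n of recfn n & recfn n.+2 : recfn n.+1
| rMin n of recfn n.+1 : recfn n.

(* Graph of h(0, x) = f(x), h(i+1, x) = g(i, h(i, x), x). *)
Fixpoint prim_graph n (f : n.-tuple nat -> nat -> Prop)
    (g : n.+2.-tuple nat -> nat -> Prop) (i : nat) (x : n.-tuple nat) (y : nat) :
    Prop :=
  if i is i'.+1 then
    exists2 r, prim_graph f g i' x r & g [tuple of i' :: r :: x] y
  else f x y.

(* [rec_eval f x y]: the partial function denoted by f is defined at x, with
   value y. *)
Fixpoint rec_eval n (f : recfn n) : n.-tuple nat -> nat -> Prop :=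
  match f in recfn n return n.-tuple nat -> nat -> Prop with
  | rZero _ => fun _ y => y = 0
  | rSucc => fun x y => y = (thead x).+1
  | rProj _ i => fun x y => y = tnth x i
  | rComp m _ f gs => fun x y =>
      exists2 z : m.-tuple nat,
        forall i, rec_eval (gs i) x (tnth z i) & rec_eval f z y
  | rPrim _ f g => fun x y =>
      prim_graph (rec_eval f) (rec_eval g) (thead x) (behead_tuple x) y
  | rMin _ f => fun x y =>
      rec_eval f [tuple of y :: x] 0 /\
      forall z, z < y -> exists w, rec_eval f [tuple of z :: x] w.+1
  end.

Definition computable (P Q : problem) (f : input P -> input Q) : Prop :=
  exists e : recfn 1,
    forall x, rec_eval e [tuple code_input x] (code_input (f x)).

Definition reduces (P Q : problem) : Prop :=
  exists2 f : input P -> input Q,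
    computable f & forall x, answer x <-> answer (f x).

(* Main.v *)
From mathcomp Require Import all_boot.
From mathcomp Require Import boolp.
Require Import Defs.
Set Implicit Arguments.
Unset Strict Implicit.
Unset Printing Implicit Defensive.

Import CodeSeq.

(** Let M be a finite Nmatrix with values V and designated values D.  Add a
unary connective, box, to the signature, and attach to each value a flag bit:
the new values are V * bool, and designation is read off the flag alone.  The
connectives of M act on the V-components as in M and leave the flag of their
result free.  The box leaves its V-component free; its flag must be true when
the V-component of the argument lies in a set E, and is free otherwise.
[box_nmatrix E] is this Nmatrix.

When every formula of M can be kept out of E by some valuation, flags are
almost unconstrained: to refute A from G not containing A, raise the flag of
every formula except A.  The only possible obstacle is A = box B with the
V-component of B in E.  Boxed formulas have free V-components, so they may all
be given the value of one variable; then B gets the value of a formula of the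
original signature, and a valuation keeping that formula out of E can be
chosen.  Hence G entails A iff A is in G ([entails_box]).

This always applies to E = set0.  For E = D it applies exactly when M has no
theorem, and then both Nmatrices have the same consequence relation.  If M has
a theorem A, then box A is a theorem for E = D ([theorem_box]) but not for
E = set0.  So M has a theorem iff the Nmatrices for D and set0 are not
equivalent.

For computability, a function of finitely many naturals is treated as a
function of an environment r : nat -> nat, and shown to be denoted by a term of
[recfn] through closure lemmas: arithmetic by iteration, division and list
decoding by minimization, and lists [seq f i | i <- iota 0 k] by iterating the
code of cons.  The code of [box_nmatrix E] is then obtained from that of M by
nested lists of this kind ([box_codeE]); the one arithmetical point is that the
row of a truth table of M needed for row i of the new table is found by halving
the digits of i ([digits_half]). *)

(** * Recursive functions of an environment *)

Definition tuple_of_env n (r : nat -> nat) : n.-tuple nat :=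
  [tuple r i | i < n].

(** Only r 0, ..., r (n - 1) are passed to the term, so the definition forces f
to ignore the rest of the environment.  Variables are de Bruijn indices: a bound
variable is r 0, and the outer environment is then fun i => r i.+1. *)
Definition is_recursive n (f : (nat -> nat) -> nat) : Prop :=
  exists e : recfn n, forall r, rec_eval e (tuple_of_env n r) (f r).

Definition push a (r : nat -> nat) i := if i is j.+1 then r j else a.

Lemma tuple_of_env_push n a r :
  tuple_of_env n.+1 (push a r) = [tuple of a :: tuple_of_env n r].
Proof.
apply: eq_from_tnth => i; rewrite tnth_mktuple.
by case: (unliftP ord0 i) => [j|] ->; rewrite ?tnthS ?tnth_mktuple.
Qed.

(* Opacity keeps the search syntax-directed: a closure lemma is applied only to
   the operation that it is about. *)
Create HintDb rec discriminated.
#[local] Hint Constants Opaque : rec.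
#[local] Hint Extern 0 (is_true (leq _ _)) => exact isT : rec.
Ltac recursive := auto 100 with rec nocore.

Lemma rec_var n i : i < n -> is_recursive n (fun r => r i).
Proof.
by move=> lti; exists (rProj (Ordinal lti)) => r /=; rewrite tnth_mktuple.
Qed.

(** Composition, and also weakening and exchange of variables. *)
Lemma rec_subst m n f (g : nat -> (nat -> nat) -> nat) :
  is_recursive m f -> (forall i, i < m -> is_recursive n (g i)) ->
  is_recursive n (fun r => f (fun i => g i r)).
Proof.
move=> [e eP] gP.
have [gs gsP] := choice (fun i : 'I_m => gP i (ltn_ord i)).
exists (rComp e gs) => r; exists (tuple_of_env m (fun i => g i r)) => [i|].
  by rewrite tnth_mktuple; apply: gsP.
exact: eP.
Qed.

Lemma rec_shift n f :
  is_recursive n f -> is_recursive n.+1 (fun r => f (fun i => r i.+1)).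
Proof.
move=> fP; apply: (rec_subst (g := fun i r => r i.+1) fP) => i lti.
exact: rec_var.
Qed.

Lemma rec_comp1 n (g : nat -> nat) f :
  is_recursive 1 (fun r => g (r 0)) -> is_recursive n f ->
  is_recursive n (fun r => g (f r)).
Proof. by move=> gP fP; apply: (rec_subst (g := fun=> f) gP). Qed.

Lemma rec_comp2 n (g : nat -> nat -> nat) f1 f2 :
  is_recursive 2 (fun r => g (r 0) (r 1)) ->
  is_recursive n f1 -> is_recursive n f2 ->
  is_recursive n (fun r => g (f1 r) (f2 r)).
Proof.
move=> gP f1P f2P.
by apply: (rec_subst (g := fun i => if i is 0 then f1 else f2) gP) => -[].
Qed.

Lemma rec_succ n f : is_recursive n f -> is_recursive n (fun r => (f r).+1).
Proof.
move=> fP; apply: (@rec_comp1 n S) => //; exists rSucc => r /=.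
by rewrite /thead tnth_mktuple.
Qed.

Lemma rec_const n c : is_recursive n (fun => c).
Proof.
elim: c => [|c IHc]; first by exists (rZero n).
exact: rec_succ.
Qed.

(** In the step, r 0 is the iteration counter and r 1 the previous value. *)
Lemma rec_iteri n (k a : (nat -> nat) -> nat)
    (s : (nat -> nat) -> nat -> nat -> nat) :
  is_recursive n k -> is_recursive n a ->
  is_recursive n.+2 (fun r => s (fun i => r i.+2) (r 0) (r 1)) ->
  is_recursive n (fun r => iteri (k r) (s r) (a r)).
Proof.
move=> [ek ekP] [ea eaP] [es esP].
exists (rComp (rPrim ea es)
  (fun i => if unlift ord0 i is Some j then rProj j else ek)) => r /=.
exists [tuple of k r :: tuple_of_env n r].
  by move=> i; case: unliftP => [j|] -> /=; rewrite ?tnthS ?tnth0.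
have -> : behead_tuple [tuple of k r :: tuple_of_env n r] = tuple_of_env n r.
  exact: val_inj.
rewrite theadE; elim: (k r) => [|i IHi] /=; first exact: eaP.
eexists; first exact: IHi.
by have:= esP (push i (push (iteri i (s r) (a r)) r));
  rewrite !tuple_of_env_push.
Qed.

(** The predicate is negated because minimization looks for a zero. *)
Lemma rec_min n (P : (nat -> nat) -> nat -> bool) f :
  is_recursive n.+1 (fun r => ~~ P (fun i => r i.+1) (r 0)) ->
  (forall r, P r (f r)) -> (forall r y, y < f r -> ~~ P r y) ->
  is_recursive n f.
Proof.
move=> [e eP] Pf fmin; exists (rMin e) => r /=; split.
  by have:= eP (push (f r) r); rewrite tuple_of_env_push /= Pf.
move=> y /fmin ltyf; exists 0.
by have:= eP (push y r); rewrite tuple_of_env_push /= ltyf.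
Qed.

#[local] Hint Resolve rec_const rec_var rec_succ rec_iteri : rec.

Lemma rec_pred n f : is_recursive n f -> is_recursive n (fun r => (f r).-1).
Proof.
apply: rec_comp1.
suff: is_recursive 1 (fun r => iteri (r 0) (fun i _ => i) 0).
  by congr is_recursive; apply/funext => r; case: (r 0).
recursive.
Qed.
#[local] Hint Resolve rec_pred : rec.

Lemma rec_ext n f g : f =1 g -> is_recursive n f -> is_recursive n g.
Proof. by move=> /funext ->. Qed.

Lemma rec_add n f g : is_recursive n f -> is_recursive n g ->
  is_recursive n (fun r => f r + g r).
Proof.
apply: rec_comp2.
apply: (@rec_ext _ (fun r => iteri (r 0) (fun _ m => m.+1) (r 1)));
  last recursive.
by move=> r; elim: (r 0) => //= i ->.
Qed.
#[local] Hint Resolve rec_add : rec.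

Lemma rec_sub n f g : is_recursive n f -> is_recursive n g ->
  is_recursive n (fun r => f r - g r).
Proof.
apply: rec_comp2.
apply: (@rec_ext _ (fun r => iteri (r 1) (fun _ m => m.-1) (r 0)));
  last recursive.
by move=> r; elim: (r 1) => [|i IHi] /=; rewrite ?subn0 // subnS IHi.
Qed.
#[local] Hint Resolve rec_sub : rec.

Lemma rec_mul n f g : is_recursive n f -> is_recursive n g ->
  is_recursive n (fun r => f r * g r).
Proof.
apply: rec_comp2.
apply: (@rec_ext _ (fun r => iteri (r 0) (fun _ m => r 1 + m) 0));
  last recursive.
by move=> r; elim: (r 0) => //= i ->.
Qed.
#[local] Hint Resolve rec_mul : rec.

Lemma rec_exp n f g : is_recursive n f -> is_recursive n g ->
  is_recursive n (fun r => f r ^ g r).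
Proof.
apply: rec_comp2.
apply: (@rec_ext _ (fun r => iteri (r 1) (fun _ m => r 0 * m) 1));
  last recursive.
by move=> r; elim: (r 1) => //= i ->; rewrite expnS.
Qed.
#[local] Hint Resolve rec_exp : rec.

Lemma rec_double n f : is_recursive n f -> is_recursive n (fun r => (f r).*2).
Proof.
by move=> fP; apply: rec_ext (rec_add fP fP) => r; rewrite addnn.
Qed.

Lemma rec_neg n (b : (nat -> nat) -> bool) :
  is_recursive n (fun r => b r) -> is_recursive n (fun r => ~~ b r).
Proof.
move=> bP; apply: rec_ext (rec_sub (rec_const n 1) bP) => r.
by case: (b r).
Qed.

Lemma rec_and n (b c : (nat -> nat) -> bool) :
  is_recursive n (fun r => b r) -> is_recursive n (fun r => c r) ->
  is_recursive n (fun r => b r && c r).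
Proof.
by move=> bP cP; apply: rec_ext (rec_mul bP cP) => r; case: (b r); case: (c r).
Qed.
#[local] Hint Resolve rec_double rec_neg rec_and : rec.

Lemma rec_or n (b c : (nat -> nat) -> bool) :
  is_recursive n (fun r => b r) -> is_recursive n (fun r => c r) ->
  is_recursive n (fun r => b r || c r).
Proof.
move=> bP cP; apply: (@rec_ext _ (fun r => ~~ (~~ b r && ~~ c r)));
  last recursive.
by move=> r; case: (b r); case: (c r).
Qed.

Lemma rec_imp n (b c : (nat -> nat) -> bool) :
  is_recursive n (fun r => b r) -> is_recursive n (fun r => c r) ->
  is_recursive n (fun r => b r ==> c r).
Proof.
move=> bP cP; apply: (@rec_ext _ (fun r => ~~ (b r && ~~ c r)));
  last recursive.
by move=> r; case: (b r); case: (c r).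
Qed.

Lemma rec_leq n f g : is_recursive n f -> is_recursive n g ->
  is_recursive n (fun r => f r <= g r).
Proof.
move=> fP gP; apply: (@rec_ext _ (fun r => 1 - (f r - g r)));
  last recursive.
by move=> r; rewrite /leq; case: (f r - g r).
Qed.
#[local] Hint Resolve rec_or rec_imp rec_leq : rec.

Lemma rec_eq n f g : is_recursive n f -> is_recursive n g ->
  is_recursive n (fun r => f r == g r).
Proof.
move=> fP gP; apply: (@rec_ext _ (fun r => (f r <= g r) && (g r <= f r))).
  by move=> r; rewrite eqn_leq.
recursive.
Qed.
#[local] Hint Resolve rec_eq : rec.

Lemma rec_if n (b : (nat -> nat) -> bool) f g :
  is_recursive n (fun r => b r) -> is_recursive n f -> is_recursive n g ->
  is_recursive n (fun r => if b r then f r else g r).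
Proof.
move=> bP fP gP.
apply: (@rec_ext _ (fun r => b r * f r + (~~ b r) * g r)); last recursive.
by move=> r; case: (b r); rewrite ?mul1n ?addn0.
Qed.
#[local] Hint Resolve rec_if : rec.

Lemma rec_div n f g : is_recursive n f -> is_recursive n g ->
  is_recursive n (fun r => f r %/ g r).
Proof.
apply: rec_comp2.
apply: (@rec_min _ (fun r q => (r 1 == 0) || (r 0 < q.+1 * r 1))).
- recursive.
- move=> r; case: posnP => //= d0.
  by rewrite {1}(divn_eq (r 0) (r 1)) mulSn addnC ltn_add2r ltn_mod.
move=> r q; case: posnP => [->|d0 ltq] //=.
by rewrite -leqNgt (leq_trans _ (leq_divM (r 0) (r 1))) ?leq_mul2r ?ltq ?orbT.
Qed.
#[local] Hint Resolve rec_div : rec.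

Lemma rec_mod n f g : is_recursive n f -> is_recursive n g ->
  is_recursive n (fun r => f r %% g r).
Proof.
move=> fP gP.
apply: (@rec_ext _ (fun r => f r - f r %/ g r * g r)); last recursive.
by move=> r; rewrite {1}(divn_eq (f r) (g r)) addKn.
Qed.
#[local] Hint Resolve rec_mod : rec.

Lemma rec_half n f : is_recursive n f -> is_recursive n (fun r => (f r)./2).
Proof.
move=> fP; apply: (@rec_ext _ (fun r => f r %/ 2)); last recursive.
by move=> r; rewrite divn2.
Qed.

Lemma rec_odd n f : is_recursive n f -> is_recursive n (fun r => odd (f r)).
Proof.
move=> fP; apply: (@rec_ext _ (fun r => f r %% 2)); last recursive.
by move=> r; rewrite modn2.
Qed.
#[local] Hint Resolve rec_half rec_odd : rec.


Lemma rec_sum n (k : (nat -> nat) -> nat) (f : (nat -> nat) -> nat -> nat) :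
  is_recursive n k ->
  is_recursive n.+1 (fun r => f (fun i => r i.+1) (r 0)) ->
  is_recursive n (fun r => \sum_(0 <= i < k r) f r i).
Proof.
move=> kP fP.
apply: (@rec_ext _ (fun r => iteri (k r) (fun i m => m + f r i) 0)).
  move=> r; elim: (k r) => [|i IHi] /=; first by rewrite big_nil.
  by rewrite big_nat_recr //= IHi.
apply: (rec_iteri kP (rec_const n 0)).
apply: rec_add; first exact: rec_var.
apply: (rec_subst (g := fun i r => if i is j.+1 then r j.+2 else r 0) fP).
by case=> [|i] lti; apply: rec_var.
Qed.
#[local] Hint Resolve rec_sum : rec.



(** * Recursive functions on coded sequences *)

Lemma rec_cons n f (s : (nat -> nat) -> seq nat) :
  is_recursive n f -> is_recursive n (fun r => code (s r)) ->
  is_recursive n (fun r => code (f r :: s r)).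
Proof.
move=> fP sP.
apply: (@rec_ext _ (fun r => 2 ^ f r * (code (s r)).*2.+1)) => //; recursive.
Qed.
#[local] Hint Resolve rec_cons : rec.

(** The code of a sequence is built from its last item to its first, so the
iteration runs through iota 0 k downwards: its step j treats k - j.+1. *)
Lemma rec_map_filter n k (f : (nat -> nat) -> nat -> nat)
    (p : (nat -> nat) -> nat -> bool) :
  is_recursive n.+1 (fun r => f (fun i => r i.+1) (r 0)) ->
  is_recursive n.+1 (fun r => p (fun i => r i.+1) (r 0)) ->
  is_recursive n k ->
  is_recursive n (fun r => code [seq f r i | i <- iota 0 (k r) & p r i]).
Proof.
move=> fP pP kP.
pose step r j m :=
  let i := k r - j.+1 in if p r i then 2 ^ f r i * m.*2.+1 else m.
apply: (@rec_ext _ (fun r => iteri (k r) (step r) 0)) => [r|].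
  suff H j : j <= k r -> iteri j (step r) 0 =
      code [seq f r i | i <- iota (k r - j) j & p r i].
    by rewrite H // subnn.
  elim: j => //= j IHj ltjk.
  rewrite IHj 1?ltnW // /step -subSn // subSS.
  by case: (p r _).
apply: rec_iteri => //; first exact: rec_const.
rewrite /step.
(* Substitutes the item treated at step r 0 for the bound variable of h. *)
have stepP h : is_recursive n.+1 (fun r => h (fun i => r i.+1) (r 0)) ->
    is_recursive n.+2
      (fun r => h (fun i => r i.+2) (k (fun i => r i.+2) - (r 0).+1)).
  move=> hP.
  apply: (rec_subst (g := fun i r => if i is j.+1 then r j.+2
                          else k (fun i => r i.+2) - (r 0).+1) hP).
  case=> [|i] lti; last exact: rec_var.
  apply: rec_sub; last recursive.
  exact: rec_shift (rec_shift kP).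
apply: rec_if; [exact: (stepP (fun r i => p r i)) | | recursive].
apply: rec_mul; last recursive.
apply: rec_exp; [recursive | exact: stepP].
Qed.

Lemma rec_map n k (f : (nat -> nat) -> nat -> nat) :
  is_recursive n.+1 (fun r => f (fun i => r i.+1) (r 0)) ->
  is_recursive n k ->
  is_recursive n (fun r => code [seq f r i | i <- iota 0 (k r)]).
Proof.
move=> fP kP.
have pP : is_recursive n.+1 (fun=> true) by exact: (rec_const _ 1).
apply: rec_ext (rec_map_filter (p := fun _ _ => true) fP pP kP) => r.
by rewrite filter_predT.
Qed.

Lemma rec_filter n k (p : (nat -> nat) -> nat -> bool) :
  is_recursive n.+1 (fun r => p (fun i => r i.+1) (r 0)) ->
  is_recursive n k ->
  is_recursive n (fun r => code [seq i <- iota 0 (k r) | p r i]).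
Proof.
move=> pP kP.
apply: rec_ext (rec_map_filter (f := fun _ i => i) _ pP kP); last recursive.
by move=> r; rewrite map_id.
Qed.
#[local] Hint Resolve rec_map rec_filter : rec.

Lemma rec_has n k (p : (nat -> nat) -> nat -> bool) :
  is_recursive n k ->
  is_recursive n.+1 (fun r => p (fun i => r i.+1) (r 0)) ->
  is_recursive n (fun r => has (p r) (iota 0 (k r))).
Proof.
move=> kP pP.
apply: (@rec_ext _ (fun r => 0 < \sum_(0 <= i < k r) p r i));
  last recursive.
move=> r; rewrite lt0n sum_nat_seq_neq0; congr nat_of_bool.
rewrite /index_iota subn0; apply: eq_has => i /=.
by case: (p r i).
Qed.

(** code (a :: s) = 2 ^ a * (2 * code s + 1), so the head is the least exponent
whose power of 2 leaves an odd quotient; 0 codes the empty sequence. *)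
Lemma rec_head n f :
  is_recursive n f -> is_recursive n (fun r => head 0 (decode (f r))).
Proof.
apply: (rec_comp1 (g := fun m => head 0 (decode m))).
apply: (@rec_min _ (fun r h => (r 0 == 0) || odd (r 0 %/ 2 ^ h))).
- recursive.
- move=> r; rewrite -{1 2}[r 0]decodeK; case: (decode _) => //= a s.
  by rewrite mulKn ?expn_gt0 //= odd_double orbT.
move=> r y; rewrite -{2 3}[r 0]decodeK; case: (decode _) => //= a s ltya.
rewrite muln_eq0 expn_eq0 /= -(subnK (ltnW ltya)) expnD mulnAC.
rewrite mulnK ?expn_gt0 //.
by rewrite oddM oddX subn_eq0 leqNgt ltya.
Qed.
#[local] Hint Resolve rec_head : rec.

Lemma rec_behead n f :
  is_recursive n f -> is_recursive n (fun r => code (behead (decode (f r)))).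
Proof.
move=> fP.
apply: (@rec_ext _ (fun r => (f r %/ 2 ^ head 0 (decode (f r)))./2));
  last recursive.
move=> r; rewrite -{1}[f r]decodeK; case: (decode _) => //= a s.
by rewrite mulKn ?expn_gt0 //= uphalf_double.
Qed.
#[local] Hint Resolve rec_behead : rec.

Lemma rec_drop n f g : is_recursive n f -> is_recursive n g ->
  is_recursive n (fun r => code (drop (g r) (decode (f r)))).
Proof.
move=> fP gP.
apply: (@rec_ext _
  (fun r => iteri (g r) (fun _ m => code (behead (decode m))) (f r)));
  last recursive.
move=> r; elim: (g r) => [|i IHi] /=; first by rewrite drop0 decodeK.
by rewrite IHi codeK -!drop1 drop_drop.
Qed.
#[local] Hint Resolve rec_drop : rec.

Lemma rec_nth n f g : is_recursive n f -> is_recursive n g ->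
  is_recursive n (fun r => nth 0 (decode (f r)) (g r)).
Proof.
move=> fP gP.
apply: (@rec_ext _
  (fun r => head 0 (decode (code (drop (g r) (decode (f r))))))).
  by move=> r; rewrite codeK -nth0 nth_drop addn0.
recursive.
Qed.

Lemma rec_size n f :
  is_recursive n f -> is_recursive n (fun r => size (decode (f r))).
Proof.
apply: (rec_comp1 (g := fun m => size (decode m))).
apply: (@rec_min _ (fun r j => code (drop j (decode (r 0))) == 0)).
- recursive.
- by move=> r; rewrite drop_size.
move=> r y lty; apply/negP => /eqP e0.
have: code (drop y (decode (r 0))) = code [::] by [].
by move/code_inj/(congr1 size)/eqP; rewrite size_drop subn_eq0 leqNgt lty.
Qed.
#[local] Hint Resolve rec_has rec_nth rec_size : rec.

Lemma rec_mem n f g : is_recursive n f -> is_recursive n g ->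
  is_recursive n (fun r => f r \in decode (g r)).
Proof.
move=> fP gP.
apply: (@rec_ext _ (fun r => has (fun j => nth 0 (decode (g r)) j == f r)
                                 (iota 0 (size (decode (g r)))))).
  move=> r; congr nat_of_bool; apply/hasP/idP => [[j]|].
    by rewrite mem_iota => ltj /eqP <-; apply: mem_nth.
  by move/(nthP 0) => [j ltj <-]; exists j; rewrite ?mem_iota.
apply: rec_has; first recursive.
apply: rec_eq; last exact: rec_shift.
by apply: rec_nth; [exact: rec_shift | recursive].
Qed.
#[local] Hint Resolve rec_mem : rec.

(** * Adding a box and flags to an Nmatrix *)

(** Valuations exist because the multi-functions have nonempty values: choose
values by recursion on formulas. *)
Fixpoint some_valuation s (M : fin_nmatrix s) (A : formula (sig_of s)) :
    'I_(fn_n M).+1 :=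
  if A is App k c a then
    odflt ord0 [pick y in fn_op M c [ffun i => some_valuation M (a i)]]
  else ord0.

Lemma some_valuationP s (M : fin_nmatrix s) :
  @is_valuation _ (nmatrix_of M) (some_valuation M).
Proof.
move=> k c a /=; case: pickP => [y //|none].
have /set0Pn [y yP] := fn_op_nonempty c [ffun i => some_valuation M (a i)].
by have := none y; rewrite /= yP.
Qed.

(** Arity 1 must be inside the list, whence a size of at least 2; trailing
zeros do not change the signature. *)
Definition box_sig (s : fin_sig) : fin_sig :=
  mkseq (fun k => nth 0 s k + (k == 1)) (size s).+2.

Lemma nth_box_sig s k : nth 0 (box_sig s) k = nth 0 s k + (k == 1).
Proof.
have [ltk|lek] := ltnP k (size s).+2; first by rewrite nth_mkseq.
rewrite !nth_default ?size_mkseq //; first by case: k lek => [|[]].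
exact: ltnW (ltnW lek).
Qed.

Lemma keep_conn_proof s k (c : sig_of s k) : c < nth 0 (box_sig s) k.
Proof. by rewrite nth_box_sig ltn_addr. Qed.

Definition keep_conn s k (c : sig_of s k) : sig_of (box_sig s) k :=
  Ordinal (keep_conn_proof c).

Lemma box_proof s : nth 0 s 1 < nth 0 (box_sig s) 1.
Proof. by rewrite nth_box_sig addn1. Qed.

Definition box s : sig_of (box_sig s) 1 := Ordinal (box_proof s).

(** A partial inverse of [keep_conn], undefined only at the box; it avoids
transporting connectives along [nth_box_sig]. *)
Definition kept s k (c : sig_of (box_sig s) k) : option (sig_of s k) :=
  insub (val c).

Lemma keep_connK s k (c : sig_of s k) : kept (keep_conn c) = Some c.
Proof. exact: valK. Qed.

Lemma kept_box s : kept (box s) = None.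
Proof. by rewrite /kept insubF ?ltnn. Qed.

Lemma kept_None s k (c : sig_of (box_sig s) k) : kept c = None -> k = 1.
Proof.
rewrite /kept; case: insubP => // + _; have := ltn_ord c.
rewrite [X in _ < X]nth_box_sig; case: eqP => // _.
by rewrite addn0 => ->.
Qed.

(** The pair (a, b) of V * bool is represented by b + 2 a. *)
Lemma half_proof n (v : 'I_n.+1.*2) : v./2 < n.+1.
Proof. by rewrite ltn_half_double. Qed.

Definition half_ord n (v : 'I_n.+1.*2) : 'I_n.+1 := Ordinal (half_proof v).

Lemma flagged_proof n (a : 'I_n.+1) (b : bool) : b + a.*2 < n.+1.*2.
Proof.
have := ltn_ord a; rewrite -leq_double doubleS; apply: leq_trans.
by case: b.
Qed.

Definition flagged n (a : 'I_n.+1) (b : bool) : 'I_n.+1.*2 :=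
  Ordinal (flagged_proof a b).

Lemma half_flagged n (a : 'I_n.+1) b : half_ord (flagged a b) = a.
Proof. by apply: val_inj; rewrite /= half_bit_double. Qed.

Lemma odd_flagged n (a : 'I_n.+1) b : odd (flagged a b) = b.
Proof. by rewrite /= oddD odd_double addbF oddb. Qed.

(** The clause for the box is written for every arity, with an existential over
the arguments, so that no cast to arity 1 is needed. *)
Definition box_op s (M : fin_nmatrix s) (E : {set 'I_(fn_n M).+1})
    k (c : sig_of (box_sig s) k) :
    {ffun ('I_(fn_n M).+1.*2 ^ k)%type -> {set 'I_(fn_n M).+1.*2}} :=
  [ffun x : ('I_(fn_n M).+1.*2 ^ k)%type => if kept c is Some c0
    then [set v | half_ord v \in fn_op M c0 [ffun i => half_ord (x i)]]
    else [set v : 'I__ | [exists i, half_ord (x i) \in E] ==> odd v]].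

Lemma box_op_nonempty s (M : fin_nmatrix s) (E : {set 'I_(fn_n M).+1})
    k (c : sig_of (box_sig s) k) x : box_op E c x != set0.
Proof.
apply/set0Pn; rewrite ffunE; case: (kept c) => [c0|].
  have /set0Pn [y yP] := fn_op_nonempty c0 [ffun i => half_ord (x i)].
  by exists (flagged y true); rewrite inE half_flagged.
by exists (flagged ord0 true); rewrite inE odd_flagged implybT.
Qed.

Definition box_nmatrix s (M : fin_nmatrix s) (E : {set 'I_(fn_n M).+1}) :
    fin_nmatrix (box_sig s) :=
  @FinNmatrix (box_sig s) (fn_n M).*2.+1
    [set v : 'I_(fn_n M).+1.*2 | odd v] (box_op E) (box_op_nonempty E).

Fixpoint embed s (A : formula (sig_of s)) : formula (sig_of (box_sig s)) :=
  match A with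
  | Var p => Var _ p
  | App k c a => App (keep_conn c) [ffun i => embed (a i)]
  end.

(** Any formula would do in place of the variable: the V-component of a boxed
formula is free, so all boxed formulas can share one. *)
Fixpoint unbox s (A : formula (sig_of (box_sig s))) : formula (sig_of s) :=
  match A with
  | Var p => Var _ p
  | App k c a =>
    if kept c is Some c0 then App c0 [ffun i => unbox (a i)] else Var _ 0
  end.

Lemma half_valuation s (M : fin_nmatrix s) (E : {set 'I_(fn_n M).+1}) v :
  @is_valuation _ (nmatrix_of (box_nmatrix E)) v ->
  @is_valuation _ (nmatrix_of M) (fun A => @half_ord (fn_n M) (v (embed A))).
Proof.
move=> vP k c a; have := vP k (keep_conn c) [ffun i => embed (a i)].
rewrite /= ffunE keep_connK inE; congr (_ \in fn_op _ _ _).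
by apply/ffunP => i; rewrite !ffunE.
Qed.

(** V-components and flags can be prescribed independently, up to the constraint
that the box puts on flags. *)
Lemma flagged_valuation s (M : fin_nmatrix s) (E : {set 'I_(fn_n M).+1})
    (v : formula (sig_of s) -> 'I_(fn_n M).+1)
    (flag : formula (sig_of (box_sig s)) -> bool) :
  @is_valuation _ (nmatrix_of M) v ->
  (forall k (c : sig_of (box_sig s) k) (a : (formula _ ^ k)%type),
    kept c = None ->
    (exists i, v (unbox (a i)) \in E) -> flag (App c a)) ->
  @is_valuation _ (nmatrix_of (box_nmatrix E))
    (fun A => flagged (v (unbox A)) (flag A)).
Proof.
move=> vP flagP k c a; rewrite /= ffunE.
case keptc: (kept c) => [c0|]; rewrite inE ?half_flagged ?odd_flagged.
  have := vP k c0 [ffun i => unbox (a i)]; congr (_ \in fn_op _ _ _).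
  by apply/ffunP => i; rewrite !ffunE half_flagged.
apply/implyP => /existsP [i]; rewrite ffunE half_flagged => Ei.
by apply: flagP => //; exists i.
Qed.

Lemma theorem_box s (M : fin_nmatrix s) A :
  is_theorem (nmatrix_of M) A ->
  is_theorem (nmatrix_of (box_nmatrix (fn_des M)))
    (App (box s) [ffun => embed A]).
Proof.
move=> thmA v vP _; have := vP 1 (box s) [ffun => embed A].
rewrite /= ffunE kept_box !inE => /implyP; apply; apply/existsP; exists ord0.
by rewrite !ffunE; apply: (thmA _ (half_valuation vP)).
Qed.

(** Only the values at boxed formulas matter; defining it on all formulas avoids
inverting dependent equations between applications. *)
Definition box_arg s (A : formula (sig_of (box_sig s))) : formula (sig_of s) :=
  if A is App k c a then
    if [pick i : 'I_k] is Some i then unbox (a i) else Var _ 0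
  else Var _ 0.

Lemma box_argE s k (c : sig_of (box_sig s) k) (a : (formula _ ^ k)%type) i :
  kept c = None -> box_arg (App c a) = unbox (a i).
Proof.
move=> /kept_None /esym k1 /=; case: k / k1 in c a i *.
by case: pickP => [j _|/(_ i)//]; rewrite (ord1 i) (ord1 j).
Qed.

(** If A is not in G, take a valuation of M that keeps [box_arg A] out of E and
raise every flag except that of A: this satisfies G and refutes A. *)
Lemma entails_box s (M : fin_nmatrix s) (E : {set 'I_(fn_n M).+1}) G A :
  (forall B, exists2 v : formula (sig_of s) -> 'I_(fn_n M).+1,
     @is_valuation _ (nmatrix_of M) v & v B \notin E) ->
  entails (nmatrix_of (box_nmatrix E)) G A <-> G A.
Proof.
move=> refuteE; split=> [GA|AG v _]; last exact.
apply: contrapT => notGA.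
have [v vP vA] := refuteE (box_arg A).
have flagP k (c : sig_of (box_sig s) k) (a : (formula _ ^ k)%type) :
    kept c = None -> (exists i, v (unbox (a i)) \in E) -> `[< App c a <> A >].
  move=> keptc [i]; rewrite -(box_argE a i keptc) => vcE.
  by apply/asboolP => eA; move: vcE; rewrite eA (negPf vA).
have := GA _ (flagged_valuation (flag := fun B => `[< B <> A >]) vP flagP).
rewrite /= inE odd_flagged => /(_ _)/asboolP; apply=> // B GB.
by rewrite inE odd_flagged; apply/asboolP => eBA; rewrite eBA in GB.
Qed.

(** * The code of the expanded Nmatrix *)

Arguments CodeSeq.code : simpl never.

(** Sets are coded by the increasing sequence of their elements, so a set given
by a decidable condition is coded by filtering an interval. *)
Lemma val_enum_filter n (A : {set 'I_n}) (P : pred nat) :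
  (forall a : 'I_n, (a \in A) = P a) ->
  [seq val a | a <- enum A] = [seq i <- iota 0 n | P i].
Proof.
move=> AP; rewrite -val_enum_ord filter_map enumT; congr map.
exact: eq_filter.
Qed.

Lemma mem_val_enum n (A : {set 'I_n}) (a : 'I_n) :
  (val a \in [seq val b | b <- enum A]) = (a \in A).
Proof. by rewrite (mem_map val_inj) mem_enum. Qed.

Lemma base_sum_lt N k d :
  (forall j, d j < N) -> \sum_(0 <= j < k) d j * N ^ j < N ^ k.
Proof.
move=> ltd; elim: k => [|k IHk]; first by rewrite big_nil.
rewrite big_nat_recr //= expnS.
apply: (@leq_trans (N ^ k + d k * N ^ k)); first by rewrite ltn_add2r.
by rewrite -mulSn leq_mul2r ltd orbT.
Qed.

Lemma base_sum_digit N k d j : (forall i, d i < N) -> j < k ->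
  (\sum_(0 <= i < k) d i * N ^ i) %/ N ^ j %% N = d j.
Proof.
move=> ltd ltjk; have N0 : 0 < N by apply: leq_trans (ltd 0).
rewrite (big_cat_nat (n := j)) /= ?(ltnW ltjk) //. rewrite (big_ltn ltjk).
have -> : \sum_(j.+1 <= i < k) d i * N ^ i =
    (\sum_(j.+1 <= i < k) d i * N ^ (i - j.+1)) * N * N ^ j.
  rewrite -mulnA -expnS big_distrl /=; apply: eq_big_nat => i /andP [ltji _].
  by rewrite -mulnA -expnD subnK.
rewrite addnC (addnC (d j * _)) -mulnDl divnMDl ?expn_gt0 ?N0 //.
by rewrite (divn_small (base_sum_lt _ ltd)) addn0 modnMDl modn_small.
Qed.

(** Halves the base 2 N digits of i and reads the result in base N: this sends
the row of a tuple of new values to the row of its V-components. *)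
Definition half_digits N k i :=
  \sum_(0 <= j < k) (i %/ N.*2 ^ j %% N.*2)./2 * N ^ j.

Lemma digits_half n k i :
  digits n k (half_digits n.+1 k i) =
  [ffun j => half_ord (digits n.*2.+1 k i j)].
Proof.
apply/ffunP => j; rewrite !ffunE; apply: val_inj.
have ltm m : m %% n.+1.*2 < n.+1.*2 by rewrite ltn_mod.
rewrite base_sum_digit // => [|m]; last by rewrite ltn_half_double.
by rewrite /= ?ffunE !inordK ?ltn_half_double. 
Qed.

(** The entry of row i in the table of connective c of arity k, where nk is the
number of kept connectives of that arity.  At the box, k = 1 and the only
argument is i itself. *)
Definition box_entry N E ops k nk c i :=
  if c < nk then
    code [seq v <- iota 0 N.*2 | v./2 \in
      decode (nth 0 (decode (nth 0 (decode (nth 0 (decode ops) k)) c))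
                  (half_digits N k i))]
  else code [seq v <- iota 0 N.*2 | (i./2 \in decode E) ==> odd v].

Definition box_code sc N ops E :=
  code [:: N.*2; code [seq v <- iota 0 N.*2 | odd v];
    code [seq code [seq code [seq box_entry N E ops k (nth 0 (decode sc) k) c i
        | i <- iota 0 (N.*2 ^ k)]
      | c <- iota 0 (nth 0 (decode sc) k + (k == 1))]
    | k <- iota 0 (size (decode sc)).+2]].

Lemma map_val_ord (T : Type) n (f : nat -> T) :
  [seq f i | i <- iota 0 n] = [seq f (val i) | i <- enum 'I_n].
Proof. by rewrite -val_enum_ord -map_comp. Qed.

Lemma box_codeE s (M : fin_nmatrix s) (E : {set 'I_(fn_n M).+1}) :
  code_nmatrix (box_nmatrix E) =
  box_code (code s) (fn_n M).+1
    (code [seq code_ops M k | k <- iota 0 (size s)]) (code_set E).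
Proof.
rewrite /code_nmatrix /box_code /code_set codeK size_mkseq.
congr (code [:: _; code _; code _]).
  by apply: val_enum_filter => a; rewrite inE.
apply/eq_in_map => k _; rewrite /code_ops -nth_box_sig; congr code.
rewrite map_val_ord; apply: eq_map => c; congr code.
apply/eq_in_map => i; rewrite mem_iota add0n => /andP [_ lti].
rewrite /box_entry /box_nmatrix /= ffunE.
case keptc: (kept c) => [c0|].
  have ec : val c0 = val c.
    by move: keptc; rewrite /kept; case: insubP => // u _ eu [<-].
  (* Beyond size s there are no connectives, but c0 is one. *)
  have ltk : k < size s.
    rewrite ltnNge; apply/negP => /(nth_default 0) e0.
    by case: (c0) => m; rewrite e0.
  rewrite -ec ltn_ord codeK (nth_map 0) ?size_iota // nth_iota // add0n.
  rewrite /code_ops codeK.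
  have -> : nth 0 [seq code_table (fn_op M c1) | c1 <- enum 'I_(nth 0 s k)] c0 =
      code_table (fn_op M c0).
    by rewrite (nth_map c0) ?size_enum_ord ?ltn_ord // (@nth_ord_enum _ c0 c0).
  rewrite /code_table codeK.
  have lth : half_digits (fn_n M).+1 k i < (fn_n M).+1 ^ k.
    by apply: base_sum_lt => j; rewrite ltn_half_double ltn_mod.
  rewrite (nth_map 0) ?size_iota // nth_iota // add0n digits_half codeK.
  congr code; apply: val_enum_filter => v.
  by rewrite inE -mem_val_enum.
have /esym k1 := kept_None keptc.
have -> : (c < nth 0 s k) = false.
  by move: keptc; rewrite /kept; case: insubP => // /negPf.
rewrite codeK; congr code; apply: val_enum_filter => v; rewrite inE.
congr (_ ==> _).
case: k / k1 in c keptc lti *.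
have hi : i < (fn_n M).+1.*2 by rewrite -[_.*2]expn1.
rewrite -[i]/(val (Ordinal hi)) -[_./2]/(val (half_ord (Ordinal hi))).
rewrite mem_val_enum.
have eqd j : half_ord (digits (fn_n M).*2.+1 1 i j) = half_ord (Ordinal hi).
  apply: val_inj; rewrite /= ffunE (ord1 j) expn0 divn1 inordK ?ltn_mod //.
  by rewrite modn_small.
by apply/existsP/idP => [[j]|Ei]; [|exists ord0]; rewrite eqd.
Qed.

(** The arguments are substituted for variables last; substituted first, they
would occur under the binders of [box_code] in shifted environments. *)
Lemma rec_box_code n sc N ops E :
  is_recursive n sc -> is_recursive n N -> is_recursive n ops ->
  is_recursive n E ->
  is_recursive n (fun r => box_code (sc r) (N r) (ops r) (E r)).
Proof.
move=> scP NP opsP EP.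
suff H : is_recursive 4 (fun r => box_code (r 0) (r 1) (r 2) (r 3)).
  apply: (rec_subst (g := fun i => nth sc [:: sc; N; ops; E] i) H).
  by case=> [|[|[|[|]]]].
rewrite /box_code /box_entry /half_digits.
recursive.
Qed.

#[local] Hint Resolve rec_box_code : rec.

Definition thm_to_eqv_code e :=
  let sc := nth 0 (decode e) 0 in
  let m := nth 0 (decode e) 1 in
  let N := nth 0 (decode m) 0 in
  let E := nth 0 (decode m) 1 in
  let ops := nth 0 (decode m) 2 in
  code [:: code [seq nth 0 (decode sc) k + (k == 1) |
                 k <- iota 0 (size (decode sc)).+2];
    box_code sc N ops E; box_code sc N ops 0].

Definition thm_to_eqv (x : exThm_input) : Eqv_input :=
  let: existT s M := x in
  existT _ (box_sig s) (box_nmatrix (fn_des M), @box_nmatrix s M set0).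

Lemma computable_thm_to_eqv : @computable exThm_NMatr Eqv_NMatr thm_to_eqv.
Proof.
have [e eP] : is_recursive 1 (fun r => thm_to_eqv_code (r 0)).
  rewrite /thm_to_eqv_code.
  recursive.
exists e => -[s M] /=.
have := eP (fun=> code_exThm (existT _ s M)).
rewrite /thm_to_eqv_code /code_exThm /code_nmatrix /= ?codeK /= ?codeK /=.
congr (rec_eval e _ _).
  by apply: eq_from_tnth => i; rewrite tnth_mktuple (ord1 i).
rewrite /code_Eqv /= !box_codeE /box_sig.
(* The literal 0 is the code of set0. *)
by rewrite /code_set enum_set0.
Qed.

Theorem corollary19 : reduces exThm_NMatr (dual Eqv_NMatr).
Proof.
exists thm_to_eqv; first exact: computable_thm_to_eqv.
move=> [s M] /=; have unforced G A :
    entails (nmatrix_of (@box_nmatrix s M set0)) G A <-> G A.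
  apply: entails_box => B; exists (some_valuation M); last by rewrite inE.
  exact: some_valuationP.
split=> [[A thmA] eqv|neqv].
  by have /eqv/unforced := theorem_box thmA.
apply: contrapT => nothm; apply: neqv => G A.
apply: iff_trans (iff_sym (unforced G A)).
apply: entails_box => B; apply: contrapT => forced.
apply: nothm; exists B => v vP _; apply: contrapT => /negP vB.
by apply: forced; exists v.
Qed.
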